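(* Let $p>1$, $p'=\frac{p}{p-1}$, and let $g,d,h$ satisfy the hypotheses on reaction, diffusion and convection listed in the context. Let $$0<\nu:=\liminf_{t\to0+}\frac{(d(t))^{\frac1{p-1}}g(t)}{t^{p'-1}}\quad(\nu=+\infty\text{ allowed}).$$ If $$h(0)<c<h(0)+(p')^{\frac1{p'}}p^{\frac1p}\nu^{\frac1{p'}},$$ then the problem $$(d(U)|U'|^{p-2}U')'+(c-h(U))U'+g(U)=0\ \text{ on }\mathbb{R},\qquad \lim_{z\to-\infty}U(z)=1,\quad\lim_{z\to+\infty}U(z)=0$$ has no traveling wave solution $U=U(z)$, $z\in\mathbb{R}$ (solution in the sense defined in the context). In particular, if $\nu=+\infty$, this problem has no traveling wave solution for any $c>h(0)$.
   Context: Hypotheses. Reaction: $g:[0,1]\to\mathbb{R}$ is continuous, $g(0)=g(1)=0$, $g>0$ in $(0,1)$. Diffusion: $d:[0,1]\to\mathbb{R}$ is nonnegative and lower semicontinuous, $d>0$ in $(0,1)$, and there are $0=m_0<m_1<\dots<m_r<m_{r+1}=1$ such that $d$ has a jump discontinuity at $m_i$ (finite one-sided limits), $i=1,\dots,r$, and $d|_{(m_i,m_{i+1})}$ is continuous, $i=0,\dots,r$ ($d$ may be unbounded near $0$ and/or $1$). Convection: $h:[0,1]\to\mathbb{R}$ is continuous at $0$, bounded and piecewise continuous on $[0,1]$: there are $0=k_0<k_1<\dots<k_q<k_{q+1}=1$ such that $h$ has a jump discontinuity at $k_j$ (finite one-sided limits), $j=1,\dots,q$, and $h|_{(k_j,k_{j+1})}$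 is continuous, $j=0,\dots,q$. Notation. $H(U)=\int_0^U h(s)\,ds$. For $U:\mathbb{R}\to[0,1]$: $M_U=\{z: U(z)=m_i \text{ for some } i=1,\dots,r\}$, $N_U=\{z:U(z)=0\text{ or }U(z)=1\}$. $\partial$ denotes topological boundary in $\mathbb{R}$. The expression $|s|^{p-2}s$ is $0$ at $s=0$. Definition of solution. A continuous function $U:\mathbb{R}\to[0,1]$ is a solution of $(d(U)|U'|^{p-2}U')'+(c-h(U))U'+g(U)=0$ if: (a) $D_U:=\partial M_U\cup\partial N_U$ is a discrete set in $\mathbb{R}$ and $U\in C^1(\mathbb{R}\setminus D_U)$. (b) For any $z\in\partial M_U$ there exist finite one-sided derivatives $U'(z-),U'(z+)$ and $$L(z):=|U'(z-)|^{p-2}U'(z-)\lim_{\xi\to z-}d(U(\xi))=|U'(z+)|^{p-2}U'(z+)\lim_{\xi\to z+}d(U(\xi)).$$ (c) The function $v:\mathbb{R}\to\mathbb{R}$ defined by $v(z)=d(U(z))|U'(z)|^{p-2}U'(z)$ for $z\notin\partial M_U\cup\partial N_U$, $v(z)=0$ for $z\in\partial N_U$, $v(z)=L(z)$ for $z\in\partial M_U$, is continuous, and for all $z,\hat z\in\mathbb{R}$ $$v(\hat z)-v(z)+c(U(\hat z)-U(z))-(H(U(\hat z))-H(U(z)))+\int_z^{\hat z}g(U(\tau))\,d\tau=0;$$ moreover $\lim_{z\to\pm\infty}v(z)=0$. A traveling wave solution is a solution in this sense that also satisfies the boundary conditions at $\pm\infty$. *)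

(* Defs.v *)
From HB Require Import structures.
From mathcomp Require Import all_boot all_order all_algebra.
From mathcomp Require Import all_classical all_reals all_analysis.

Set Implicit Arguments.
Unset Strict Implicit.
Unset Printing Implicit Defensive.

Import Order.TTheory GRing.Theory Num.Theory.
Import numFieldNormedType.Exports.

Local Open Scope classical_set_scope.
Local Open Scope ring_scope.

(* The functions g, d, h live on [0, 1]; they are represented by total
   functions R -> R whose values outside [0, 1] are irrelevant. *)

Section coefficients.
Context {R : realType}.
Implicit Types (f g d h : R -> R) (x : R) (n r : nat) (m : nat -> R).

Definition jump_at f x :=
  exists l1 l2 : R, [/\ f y @[y --> x^'-] --> l1, f y @[y --> x^'+] --> l2
                      & l1 != l2].

(* 0 = m 0 < m 1 < ... < m n < m n.+1 = 1; n = 0 (no jump) is allowed. *)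
Definition piecewise_continuous f n m :=
  [/\ m 0%N = 0, m n.+1 = 1,
      forall i, (i <= n)%N -> m i < m i.+1,
      forall i, (1 <= i <= n)%N -> jump_at f (m i)
    & forall i, (i <= n)%N -> {in `]m i, m i.+1[, continuous f}].

Definition reaction g :=
  [/\ {within `[0, 1], continuous g}, g 0 = 0, g 1 = 0
    & forall x, 0 < x < 1 -> 0 < g x].

(* Lower semicontinuity is that of the restriction of d to [0, 1]: at points
   outside [0, 1] the topology of the subspace makes the condition void. *)
Definition diffusion d r m :=
  [/\ forall x, 0 <= x <= 1 -> 0 <= d x,
      @lower_semicontinuous (subspace `[0 : R, 1]) R (fun x => (d x)%:E),
      forall x, 0 < x < 1 -> 0 < d x
    & piecewise_continuous d r m].

Definition convection h :=
  [/\ h x @[x --> 0^'+] --> h 0,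
      exists M : R, forall x, 0 <= x <= 1 -> `|h x| <= M
    & exists (q : nat) (k : nat -> R), piecewise_continuous h q k].

End coefficients.

Section solutions.
Context {R : realType}.
Implicit Types (p c z s : R) (g d h U f : R -> R) (r : nat) (m : nat -> R).

(* |s|^(p-2) s; it is 0 at s = 0 for every p, because of the factor s. *)
Definition spow p s : R := `|s| `^ (p - 2) * s.

Definition oriented_integral f (a b : R) : R :=
  if a <= b then \int[@lebesgue_measure R]_(t in `[a, b]) f t
  else - \int[@lebesgue_measure R]_(t in `[b, a]) f t.

Definition boundary (A : set R) : set R := closure A `\` interior A.

Definition M_ r m U : set R :=
  [set z | exists2 i, (1 <= i <= r)%N & U z = m i].

Definition N_ U : set R := [set z | U z = 0 \/ U z = 1].

Definition D_ r m U : set R := boundary (M_ r m U) `|` boundary (N_ U).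

Definition diff_quot U z (e : R) : R := (U (z + e) - U z) / e.

Definition left_flux p d U z : R :=
  spow p (lim (diff_quot U z e @[e --> 0^'-])) * lim (d (U x) @[x --> z^'-]).

Definition right_flux p d U z : R :=
  spow p (lim (diff_quot U z e @[e --> 0^'+])) * lim (d (U x) @[x --> z^'+]).

(* On the boundary of M_U the common value L(z) of the one-sided fluxes is
   represented by the left one; solutions are required to have them equal. *)
Definition flux p d r m U z : R :=
  if `[< boundary (N_ U) z >] then 0
  else if `[< boundary (M_ r m U) z >] then left_flux p d U z
  else d (U z) * spow p (derive1 U z).

Definition H_ h (u : R) : R := oriented_integral h 0 u.

Definition solution p g d h r m c U :=
  let v := flux p d r m U in
  [/\ continuous U /\ (forall z, 0 <= U z <= 1),
      D_ r m U `<=` isolated (D_ r m U) /\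
      (forall z, ~ D_ r m U z -> derivable U z 1 /\ {for z, continuous (derive1 U)}),
      forall z, boundary (M_ r m U) z ->
        [/\ cvg (diff_quot U z e @[e --> 0^'-]),
            cvg (diff_quot U z e @[e --> 0^'+]),
            cvg (d (U x) @[x --> z^'-]),
            cvg (d (U x) @[x --> z^'+])
          & left_flux p d U z = right_flux p d U z],
      continuous v /\
      (forall z z', v z' - v z + c * (U z' - U z) - (H_ h (U z') - H_ h (U z))
                    + oriented_integral (g \o U) z z' = 0)
    & v x @[x --> -oo] --> (0 : R) /\ v x @[x --> +oo] --> (0 : R)].

Definition traveling_wave p g d h r m c U :=
  [/\ solution p g d h r m c U,
      U z @[z --> -oo] --> (1 : R) & U z @[z --> +oo] --> (0 : R)].

End solutions.

(* Main.v *)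
Require Import Defs.
From HB Require Import structures.
From mathcomp Require Import all_boot all_order all_algebra.
From mathcomp Require Import all_classical all_reals all_analysis.
From mathcomp Require Import ring lra.

Import Order.TTheory GRing.Theory Num.Theory.
Import numFieldNormedType.Exports.

Local Open Scope classical_set_scope.
Local Open Scope ring_scope.

(** Suppose that U is a travelling wave, and look only at its last descent to
    0: choose a small level l, the last z0 with U z0 = l, and the interval I
    of points to the right of z0 that come before the first zero of U (I is
    unbounded if there is none).  On I the wave stays in ]0, l[, so for small l
    it avoids every jump of d and h, it is C^1 there, and the flux
    v = d(U) |U'|^(p-2) U' is differentiable with
    v' = (h(U) - c) U' - g(U).
    - The flux is negative on I (lemma flux_lt0), hence U' < 0: the mean value
      theorem gives v < 0 somewhere, and v cannot climb back to 0, because at a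
      zero of v one has U' = 0 and so v' = - g(U) < 0.
    - Put w = - v and X = w / U.  With q = 1/(p-1), the definition of the flux
      gives w^q = d(U)^q |U'|, so if n < nu then close to the end of I
      g(U) >= n U^q / d(U)^q = n X^(-q) |U'|  (lemma reaction_ge).
    - With a = c - h(0) + e, the equation thus yields
      w' >= (a - n X^(-q)) U', that is
      X' >= - (X + n X^(-q) - a) (ln U)'.
    - Young's inequality says that the minimum over X > 0 of X + n X^(-q) is
      p'^(1/p') p^(1/p) n^(1/p') (lemma conjugate_young); the bound on c says
      precisely that this minimum exceeds c - h(0) when n is close enough
      to nu.  A suitable e makes it equal to a + e, and then X + e ln U is
      nondecreasing: X tends to +oo at the end of I, where U tends to 0.
    - On the other hand w - a U is nondecreasing, and it tends to 0 because
      both the flux and U vanish at the end of I; hence X <= a.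
    These two facts contradict each other (lemma no_decaying_tail).  If
    nu = +oo the bound on c holds for every c. *)

(** * Real functions: first zeros and monotonicity *)

Lemma continuous_at_ball (R : realType) (F : R -> R) (y : R) (P : R -> Prop) :
  {for y, continuous F} -> (\forall t \near F y, P t) ->
  exists2 e, 0 < e & forall x, `|x - y| < e -> P (F x).
Proof.
move=> cF PF; have /nbhs_ballP[e/= e0 He] : \forall x \near y, P (F x) by exact: cF.
by exists e => // x xy; apply: He; rewrite /ball/= distrC.
Qed.

Lemma first_zero (R : realType) (F : R -> R) (a b : R) :
  continuous F -> a <= b -> F a < 0 -> 0 <= F b ->
  exists y, [/\ a < y <= b, F y = 0 & forall x, a <= x < y -> F x < 0].
Proof.
move=> cF ab Fa Fb.
pose S := [set x | a <= x <= b /\ 0 <= F x].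
have Sb : S b by split; rewrite ?ab ?lexx.
have lbS : has_lbound S by exists a => x [/andP[]].
have ay : a <= inf S by apply: lb_le_inf; [exists b|move=> x [/andP[]]].
have yb : inf S <= b by exact: ge_inf.
have Fneg x : a <= x < inf S -> F x < 0.
  move=> /andP[ax xS]; rewrite ltNge; apply/negP => Fx.
  suff : inf S <= x by rewrite leNgt xS.
  by apply: ge_inf => //; split => //; rewrite ax/= (le_trans (ltW xS)).
have Fy0 : 0 <= F (inf S).
  rewrite leNgt; apply/negP => Fy.
  have [e e0 He] := continuous_at_ball _ _ _ _ (cF (inf S)) (lt_nbhsl Fy).
  have [|x [xab Fx] xe] := @inf_adherent _ S e e0.
    by split => //; exists b.
  have xS : inf S <= x by exact: ge_inf.
  have : F x < 0 by apply: He; rewrite ger0_norm ?subr_ge0// ltrBlDl.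
  by rewrite ltNge Fx.
have ay' : a < inf S.
  by rewrite lt_neqAle ay andbT; apply/eqP => aE; move: Fy0; rewrite -aE leNgt Fa.
exists (inf S); split => //; first by rewrite ay'.
apply/eqP; rewrite eq_le Fy0 andbT leNgt; apply/negP => Fy.
have [e e0 He] := continuous_at_ball _ _ _ _ (cF (inf S)) (lt_nbhsr Fy).
pose x := Num.max a (inf S - e / 2).
have xS : x < inf S by rewrite gt_max ay'/=; lra.
have xS' : inf S - e / 2 <= x by rewrite le_max lexx orbT.
have : F x < 0 by apply: Fneg; rewrite xS andbT le_max lexx.
have : 0 < F x by apply: He; rewrite ltr0_norm; lra.
lra.
Qed.

(** Otherwise the Caratheodory slope, which is continuous at y and would stay
    negative just before y, although F rises there from negative values to 0. *)
Lemma is_derive_first_zero (R : realType) (F : R -> R) (a y l : R) :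
  is_derive y 1 F l -> a < y -> F y = 0 -> (forall x, a <= x < y -> F x < 0) ->
  0 <= l.
Proof.
move=> /is_derive1_caratheodory[k [Fk ck <-]] ay Fy Fneg.
rewrite leNgt; apply/negP => ky.
have [e e0 He] := continuous_at_ball _ _ _ _ ck (lt_nbhsl ky).
pose x := Num.max a (y - e / 2).
have xy : x < y by rewrite gt_max ay/=; lra.
have xy' : y - e / 2 <= x by rewrite le_max lexx orbT.
have : F x < 0 by apply: Fneg; rewrite xy andbT le_max lexx.
have : k x < 0 by apply: He; rewrite ltr0_norm; lra.
have := Fk x; rewrite Fy; nra.
Qed.

Lemma is_derive_ge0_le (R : realType) (F dF : R -> R) (a b : R) :
  a <= b -> (forall x, a <= x <= b -> is_derive x 1 F (dF x)) ->
  (forall x, a <= x <= b -> 0 <= dF x) -> F a <= F b.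
Proof.
rewrite le_eqVlt => /predU1P[->//|ab] FdF dF0.
have [||c] := @MVT _ F dF a b ab.
- move=> x /[!in_itv]/= /andP[ax xb]; apply: FdF; lra.
- apply: derivable_within_continuous => x /[!in_itv]/= xab.
  by have [] := FdF _ xab.
move=> /[!in_itv]/= /andP[ac cb] FE; rewrite -subr_ge0 FE mulr_ge0//; last lra.
by apply: dF0; lra.
Qed.

(** * A decaying positive solution of a differential inequality *)

(** Here w is the opposite of the flux and phi X stands for n X^(-1/(p-1)).  Two
    monotone quantities clash: w - a U is nondecreasing with limit 0, so that
    w / U <= a, while w / U + e ln U is nondecreasing although ln U tends to
    -oo.  The end of I, finite or infinite, only enters through the last
    hypothesis, which treats both cases at once. *)
Lemma no_decaying_tail (R : realType) (I : set R) (U dU w dw phi : R -> R) (a e z0 : R) :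
  (forall x y z, I x -> I z -> x <= y <= z -> I y) -> I z0 ->
  (forall z, I z -> is_derive z 1 U (dU z)) ->
  (forall z, I z -> is_derive z 1 w (dw z)) ->
  (forall z, I z -> [/\ 0 < U z, dU z < 0 & 0 < w z]) ->
  (forall X, 0 < X -> 0 <= phi X) ->
  0 < e -> (forall X, 0 < X -> a + e <= X + phi X) ->
  (forall z, I z -> (a - phi (w z / U z)) * dU z <= dw z) ->
  (forall z n, I z -> 0 < n -> exists z', [/\ I z', z <= z', U z' < n & w z' < n]) ->
  False.
Proof.
move=> Icvx Iz0 dUP dwP sgn phi0 e0 phia dwge small.
(* w - a U increases to 0; the slack n / (1 + |a|) absorbs the sign of a *)
have wa z : I z -> w z <= a * U z.
  move=> Iz; rewrite -subr_le0.
  apply/ler_addgt0Pr => n n0; rewrite add0r.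
  have k0 : 0 < 1 + `|a| by rewrite ltr_pwDl.
  have [z' [Iz' zz' U' w']] := small z (n / (1 + `|a|)) Iz (divr_gt0 n0 k0).
  have : w z - a * U z <= w z' - a * U z'.
    apply: (@is_derive_ge0_le _ (w - (fun x => a * U x)) (fun x => dw x - a * dU x)) => // x xzz.
      apply: is_deriveB; first by apply: dwP; exact: Icvx xzz.
      apply: (@is_deriveZ _ _ _ U a).
      by apply: dUP; exact: Icvx xzz.
    have Ix : I x by exact: Icvx xzz.
    have [Ux dUx wx] := sgn x Ix.
    have := dwge x Ix; have := phi0 _ (divr_gt0 wx Ux); nra.
  move=> /le_trans; apply.
  have [Uz' _ _] := sgn z' Iz'.
  have : w z' - a * U z' <= w z' + `|a| * U z'.
    by rewrite lerD2l -mulNr ler_wpM2r ?(ltW Uz')// -normrN ler_norm.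
  move=> /le_trans; apply.
  rewrite -[leRHS](@divfK _ (1 + `|a|)) ?gt_eqF//.
  move: U' w'; set q := n / _ => U' w'.
  have := normr_ge0 a; nra.
have main z : I z -> z0 <= z -> w z0 / U z0 + e * ln (U z0) <= w z / U z + e * ln (U z).
  move=> Iz z0z.
  apply: (@is_derive_ge0_le _ (w * (fun x => (U x)^-1) + e \*: (@ln R \o U))
    (fun x => (w x *: (- (U x) ^- 2 *: dU x) + (U x)^-1 *: dw x) + e *: ((U x)^-1 * dU x))) => // x xzz.
    have Ix : I x by exact: Icvx xzz.
    have [Ux dUx wx] := sgn x Ix.
    apply: is_deriveD.
      apply: is_deriveM; first exact: dwP.
      by apply: is_deriveV; [rewrite gt_eqF|exact: dUP].
    apply: is_deriveZ; apply: is_derive1_comp; last exact: dUP.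
    exact: is_derive1_ln.
  have Ix : I x by exact: Icvx xzz.
  have [Ux dUx wx] := sgn x Ix.
  have X0 := divr_gt0 wx Ux.
  have -> : w x *: (- U x ^- 2 *: dU x) + (U x)^-1 *: dw x + e *: ((U x)^-1 * dU x) =
    (dw x - (w x / U x - e) * dU x) / U x.
    by rewrite /GRing.scale/=; field; rewrite gt_eqF.
  rewrite divr_ge0 ?(ltW Ux)// subr_ge0.
  apply: le_trans (dwge x Ix).
  by have := phia _ X0; nra.
have [U0 _ w0] := sgn z0 Iz0.
(* below the level n of U, the monotonicity in main forces w z / U z > a *)
pose L := (a - w z0 / U z0) / e.
pose n := U z0 * expR (- L).
have n0 : 0 < n by rewrite mulr_gt0 ?expR_gt0.
have [z [Iz z0z Uz _]] := small z0 n Iz0 n0.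
have [Uz0 _ wz] := sgn z Iz.
have := main z Iz z0z.
have : w z / U z <= a by rewrite ler_pdivrMr// wa.
have : ln (U z) < ln (U z0) - L.
  have -> : ln (U z0) - L = ln n by rewrite lnM ?posrE ?expR_gt0// expRK.
  by rewrite ltr_ln ?posrE.
have : e * L = a - w z0 / U z0 by rewrite mulrC divfK ?gt_eqF.
nra.
Qed.

(** * Sharp constant, flux and integrals *)

(** Young's inequality for (p X)^(1/p) and (p' n X^(-1/(p-1)))^(1/p'): the
    powers of X cancel in the product because 1/((p-1) p') = 1/p. *)
Lemma conjugate_young (R : realType) (p p' n X : R) :
  1 < p -> 0 < n -> 0 < X -> p' = p / (p - 1) ->
  p' `^ p'^-1 * p `^ p^-1 * n `^ p'^-1 <= X + n * X `^ (- (p - 1)^-1).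
Proof.
move=> p1 n0 X0 p'E.
have p0 : 0 < p by lra.
have pB0 : 0 < p - 1 by lra.
have p'0 : 0 < p' by rewrite p'E divr_gt0.
have conj : p^-1 + p'^-1 = 1.
  by rewrite p'E; field; rewrite !gt_eqF.
have qE : (p - 1)^-1 * p'^-1 = p^-1.
  by rewrite p'E; field; rewrite !gt_eqF.
set Y := X `^ _.
have Y0 : 0 < Y by rewrite powR_gt0.
have := @conjugate_powR R ((p * X) `^ p^-1) ((p' * n * Y) `^ p'^-1) p p'
  (powR_ge0 _ _) (powR_ge0 _ _) p0 p'0 conj.
rewrite -!powRrM !mulVf ?gt_eqF// !powRr1 ?mulr_ge0 ?(ltW p0) ?(ltW p'0) ?(ltW X0) ?(ltW n0) ?(ltW Y0)//.
have -> : p * X / p + p' * n * Y / p' = X + n * Y by field; rewrite !gt_eqF.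
move=> /(le_trans _); apply.
rewrite !powRM ?mulr_ge0 ?(ltW p0) ?(ltW p'0) ?(ltW X0) ?(ltW n0) ?(ltW Y0)//.
rewrite -[Y `^ _]powRrM mulNr qE powRN.
rewrite le_eqVlt; apply/orP; left; apply/eqP.
by field; rewrite gt_eqF// powR_gt0.
Qed.

Lemma spow_lt0 (R : realType) (p s D : R) : 0 < D -> (D * spow p s < 0) = (s < 0).
Proof.
move=> D0; rewrite pmulr_rlt0// /spow.
have [->|s0] := eqVneq s 0; first by rewrite mulr0 !ltxx.
by rewrite pmulr_rlt0// powR_gt0// normr_gt0.
Qed.

Lemma spow_eq0 (R : realType) (p s D : R) : 0 < D -> D * spow p s = 0 -> s = 0.
Proof.
move=> D0 /eqP; rewrite mulf_eq0 gt_eqF//= /spow.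
have [//|s0] := eqVneq s 0.
by rewrite mulf_eq0 (negbTE s0) orbF powR_eq0 normr_eq0 (negbTE s0).
Qed.

(** Raising the flux to the power 1/(p-1) gives D^(1/(p-1)) |s|, which trades
    the diffusion coefficient in the lower bound on G for the slope s. *)
Lemma reaction_ge (R : realType) (p D s u G n : R) :
  1 < p -> 0 < D -> s < 0 -> 0 < u ->
  n <= D `^ (p - 1)^-1 * G / u `^ (p / (p - 1) - 1) ->
  n * (- (D * spow p s) / u) `^ (- (p - 1)^-1) * - s <= G.
Proof.
move=> p1 D0 s0 u0.
have pB0 : 0 < p - 1 by lra.
have -> : p / (p - 1) - 1 = (p - 1)^-1 by field; rewrite gt_eqF.
set q := (p - 1)^-1 => nle.
have s0' : 0 < - s by lra.
have -> : - (D * spow p s) = D * (- s) `^ (p - 1).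
  rewrite /spow ltr0_norm// -mulrN -mulrN; congr (_ * _).
  have -> : p - 1 = (p - 2) + 1 by ring.
  by rewrite (@powRD _ _ (p - 2) 1) ?(gt_eqF s0') ?implybT// powRr1// ltW.
have uq : 0 < u `^ q by rewrite powR_gt0.
have Dq : 0 < D `^ q by rewrite powR_gt0.
rewrite powRN powRM ?mulr_ge0 ?powR_ge0 ?invr_ge0 ?(ltW D0) ?(ltW u0)//.
rewrite powRM ?powR_ge0 ?(ltW D0)// -powRrM mulfV ?gt_eqF// powRr1 ?(ltW s0')//.
have -> : u^-1 `^ q = (u `^ q)^-1.
  by rewrite -(@powR_inv1 _ u (ltW u0)) -powRrM mulN1r powRN.
have -> : n * (D `^ q * - s * (u `^ q)^-1)^-1 * - s = n * u `^ q / D `^ q.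
  by field; rewrite (gt_eqF Dq) (gt_eqF uq) (lt_eqF s0).
by rewrite ler_pdivrMr// [leRHS]mulrC -ler_pdivlMr.
Qed.

(** A strict bound in terms of a possibly infinite nu already holds for some
    real n < nu; the threshold for n is B = (A / K)^(1/s). *)
Lemma lt_scaled_poweR (R : realType) (nu : \bar R) (A K s : R) :
  0 < A -> 0 < K -> 0 < s -> (0 < nu)%E ->
  (A%:E < K%:E * poweR nu s)%E ->
  exists n, [/\ 0 < n, (n%:E < nu)%E & A < K * n `^ s].
Proof.
move=> A0 K0 s0.
have AK : 0 < A / K by rewrite divr_gt0.
pose B := (A / K) `^ s^-1.
have B0 : 0 < B by rewrite powR_gt0.
have Bs : B `^ s = A / K by rewrite -powRrM mulVf ?gt_eqF// powRr1// ltW.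
have ltB n : B < n -> A < K * n `^ s.
  move=> Bn; rewrite mulrC -ltr_pdivrMr// -Bs gt0_ltr_powR// nnegrE ltW//.
  exact: lt_trans Bn.
case: nu => [v| |//].
- rewrite lte_fin poweR_EFin -EFinM lte_fin mulrC -ltr_pdivrMr// => v0 Av.
  have Bv : B < v.
    rewrite ltNge; apply/negP => vB; move: Av; apply/negP; rewrite -leNgt -Bs.
    by rewrite ge0_ler_powR ?nnegrE// ltW.
  exists ((B + v) / 2); split; last by apply: ltB; lra.
    lra.
  by rewrite lte_fin; lra.
- move=> _ _; exists (B + 1); split; [lra|exact: ltry|apply: ltB; lra].
Qed.

Lemma lt_limf_einf (R : realType) (f : R -> R) (F : set_system R) (n : R) :
  (n%:E < limf_einf (fun t => (f t)%:E) F)%E -> exists2 V, F V & forall t, V t -> n < f t.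
Proof.
rewrite /limf_einf /limf_esup lteNr => /ereal_inf_lt[_ [V FV <-]] Vn.
exists V => // t Vt; rewrite -lte_fin -lteN2.
apply: le_lt_trans Vn; apply: ereal_sup_ubound.
by exists t.
Qed.

Lemma is_derive_oriented_integral (R : realType) (f : R -> R) (a b x : R) :
  a < x < b -> {within `[a, b], continuous f} ->
  is_derive x 1 (oriented_integral f a) (f x).
Proof.
move=> /andP[ax xb] cf.
have ab : a < b by exact: lt_trans xb.
have /(continuous_within_itvP _ ab)[cfi _ _] := cf.
have [|||dF F'] := @continuous_FTC1 R f (BLeft a) x b xb.
- by apply: continuous_compact_integrable => //; exact: segment_compact.
- by rewrite /= ?lte_fin ?bnd_simp.
- by apply: cfi; rewrite in_itv/= ax xb.
apply: (@near_eq_is_derive _ _ _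
  (fun x => \int[@lebesgue_measure R]_(t in `[a, x]) f t)).
  have := lt_nbhsr ax; apply: filterS => y ay.
  by rewrite /oriented_integral ltW.
by split => //; rewrite -derive1E F'.
Qed.

(** Continuity up to 0 provides the integrability; the upper end (x + b) / 2
    stays away from b, where h may jump. *)
Lemma is_derive_H_ (R : realType) (h : R -> R) (b x : R) :
  0 < x < b -> h y @[y --> 0^'+] --> h 0 -> {in `]0, b[, continuous h} ->
  is_derive x 1 (H_ h) (h x).
Proof.
move=> /andP[x0 xb] h0 ch.
apply: (@is_derive_oriented_integral R h 0 ((x + b) / 2)); first lra.
apply/continuous_within_itvP; first lra; split => //.
- move=> y /[!in_itv]/= /andP[y0 yb]; apply: ch; rewrite in_itv/= y0/=; lra.
- apply: cvg_at_left_filter; apply: ch; rewrite in_itv/=; lra.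
Qed.

Lemma not_boundary (R : realType) (A : set R) (z : R) :
  (\forall x \near z, ~ A x) -> ~ boundary A z.
Proof. by move=> nA [/(_ _ nA)[x [Ax]]]. Qed.

(** * The last descent of the wave to 0 *)

(** Read from right to left, this is the first zero of U - l. *)
Lemma last_crossing (R : realType) (U : R -> R) (l : R) :
  continuous U -> U z @[z --> -oo] --> (1 : R) -> U z @[z --> +oo] --> (0 : R) ->
  0 < l < 1 -> exists z0, U z0 = l /\ forall z, z0 < z -> U z < l.
Proof.
move=> cU Um Up /andP[l0 l1].
have [A [_ HA]] : \forall z \near -oo, l < U z by exact: Um _ (lt_nbhsr l1).
have [B [_ HB]] : \forall z \near +oo, U z < l by exact: Up _ (lt_nbhsl l0).
pose a := Num.min (A - 1) (B + 1).
have aA : a < A by rewrite gt_min; apply/orP; left; lra.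
have aB : a <= B + 1 by rewrite ge_min lexx orbT.
have [||||y [/andP[y1 y2] Fy Fneg]] :=
    @first_zero R (fun x => U (- x) - l) (- (B + 1)) (- a).
- move=> x; apply: cvgB; last exact: cvg_cst.
  by apply: continuous_comp; [exact: oppr_continuous|exact: cU].
- lra.
- by rewrite opprK subr_lt0 HB//; lra.
- by rewrite opprK subr_ge0 ltW// HA.
exists (- y); split; first lra.
move=> z yz; have [zB|Bz] := leP z (B + 1); last by apply: HB; lra.
by have := Fneg (- z); rewrite opprK; lra.
Qed.

(** The tail of the wave: the points beyond z0 and before the first zero of U
    after z0.  Phrasing it through positivity avoids distinguishing whether
    such a zero exists. *)
Definition tail {R : realType} (U : R -> R) (z0 : R) : set R :=
  [set z | z0 < z /\ forall y, z0 <= y <= z -> 0 < U y].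

Lemma tail_convex (R : realType) (U : R -> R) (z0 x y z : R) :
  tail U z0 x -> tail U z0 z -> x <= y <= z -> tail U z0 y.
Proof.
move=> [zx _] [_ Uz] /andP[xy yz]; split; first exact: lt_le_trans xy.
by move=> t /andP[zt ty]; apply: Uz; rewrite zt (le_trans ty).
Qed.

Lemma tail_nonempty (R : realType) (U : R -> R) (z0 : R) :
  continuous U -> 0 < U z0 -> exists z, tail U z0 z.
Proof.
move=> cU U0; have [e e0 He] := continuous_at_ball _ _ _ _ (cU z0) (lt_nbhsr U0).
exists (z0 + e / 2); split; first lra.
by move=> y /andP[y1 y2]; apply: He; rewrite ger0_norm; lra.
Qed.

(** Whether U has a first zero y beyond z0 or not, U and v tend to 0 at the end
    of the tail: by continuity and v y = 0 in the first case, by the limits at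
    +oo in the second. *)
Lemma tail_end (R : realType) (U v : R -> R) (z0 : R) :
  continuous U -> continuous v -> (forall z, 0 <= U z) ->
  U z @[z --> +oo] --> (0 : R) -> v z @[z --> +oo] --> (0 : R) ->
  (forall y, z0 < y -> U y = 0 -> (forall x, z0 <= x < y -> 0 < U x) -> v y = 0) ->
  forall z n, tail U z0 z -> 0 < n ->
  exists z', [/\ tail U z0 z', z <= z', U z' < n & - n < v z'].
Proof.
move=> cU cv U0 Up vp v0 z n [z0z Uz] n0.
have nn : - n < 0 by lra.
have [[b [z0b Ub]]|nob] := pselect (exists b, z0 <= b /\ U b = 0).
- have [||||y [/andP[y1 y2] Fy Fneg]] := @first_zero R (- U) z0 b.
  + by move=> x; apply: cvgN; exact: cU.
  + by [].
  + by rewrite oppr_lt0 Uz// lexx ltW.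
  + by rewrite oppr_ge0 Ub.
  have Uy : U y = 0 by apply/eqP; rewrite -oppr_eq0; apply/eqP.
  have Upos x : z0 <= x < y -> 0 < U x by rewrite -oppr_lt0; exact: Fneg.
  have zy : z < y.
    by rewrite ltNge; apply/negP => yz; have := Uz y; rewrite Uy ltxx yz (ltW y1) => /(_ isT).
  have vy := v0 y y1 Uy Upos.
  have [e1 e10 He1] : exists2 e, 0 < e & forall x, `|x - y| < e -> U x < n.
    by apply: (continuous_at_ball _ _ _ (fun t => t < n) (cU y)); apply: lt_nbhsl; rewrite Uy.
  have [e2 e20 He2] : exists2 e, 0 < e & forall x, `|x - y| < e -> - n < v x.
    by apply: (continuous_at_ball _ _ _ (fun t => - n < t) (cv y)); apply: lt_nbhsr; rewrite vy.
  pose e := Num.min e1 e2.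
  have e0 : 0 < e by rewrite lt_min e10.
  have ee1 : e <= e1 by rewrite ge_min lexx.
  have ee2 : e <= e2 by rewrite ge_min lexx orbT.
  pose x := Num.max z (y - e / 2).
  have zx : z <= x by rewrite le_max lexx.
  have yx : y - e / 2 <= x by rewrite le_max lexx orbT.
  have xy : x < y by rewrite gt_max zy/=; lra.
  exists x; split => //.
  + split; first exact: lt_le_trans zx.
    by move=> t /andP[t1 t2]; apply: Upos; rewrite t1 (le_lt_trans t2).
  + by apply: He1; rewrite ltr0_norm; lra.
  + by apply: He2; rewrite ltr0_norm; lra.
- have [A [_ HA]] : \forall z \near +oo, U z < n by exact: Up _ (lt_nbhsl n0).
  have [B [_ HB]] : \forall z \near +oo, - n < v z by exact: vp _ (lt_nbhsr nn).
  pose x := Num.max z (Num.max A B + 1).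
  have zx : z <= x by rewrite le_max lexx.
  have ABx : Num.max A B < x by rewrite lt_max; apply/orP; right; lra.
  move: (ABx); rewrite gt_max => /andP[Ax Bx].
  exists x; split => //; [|exact: HA|exact: HB].
  split; first exact: lt_le_trans zx.
  move=> t /andP[t1 _]; rewrite lt_neqAle U0 andbT; apply/eqP => Ut.
  by apply: nob; exists t.
Qed.

(** Continuity of g within [0, 1] suffices since U takes its values there. *)
Lemma continuous_comp_within (R : realType) (g U : R -> R) :
  {within `[0, 1], continuous g} -> continuous U -> (forall z, 0 <= U z <= 1) ->
  continuous (g \o U).
Proof.
move=> /subspace_continuousP cg cU U01 z.
apply: (@cvg_comp _ _ _ U g (nbhs z) (within `[0, 1] (nbhs (U z)))); last first.
  by apply: cg; rewrite /= ?in_itv/=; apply: U01.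
move=> A wA.
have wA' : nbhs (U z) [set y | (`[0, 1]%classic : set R) y -> A y] by [].
have near_A : \forall x \near z, U x \in `[0, 1] -> A (U x) := cU z _ wA'.
suff : \forall x \near z, A (U x) by [].
by apply: filterS near_A => x; apply; rewrite in_itv/= U01.
Qed.

Section decay.
Variables (R : realType) (p c : R) (g d h : R -> R) (r : nat) (m : nat -> R).
Variables (U : R -> R) (l z0 : R).
Hypothesis (hg : reaction g) (d_gt0 : forall x, 0 < x < 1 -> 0 < d x).
Hypothesis (m_ge : forall i, (1 <= i <= r)%N -> l < m i) (l0 : 0 < l) (l1 : l < 1).
Hypothesis (h_derive : forall u, 0 < u < l -> is_derive u 1 (H_ h) (h u)).
Hypothesis (solU : solution p g d h r m c U).
Hypothesis (Uz0 : U z0 = l) (U_lt : forall z, z0 < z -> U z < l).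

Let v := flux p d r m U.
Let I := tail U z0.

Let cU : continuous U. Proof. by have [[]] := solU. Qed.
Let cv : continuous v. Proof. by have [_ _ _ []] := solU. Qed.
Let U01 z : 0 <= U z <= 1. Proof. by have [[]] := solU. Qed.

Lemma tail_range z : I z -> 0 < U z < l.
Proof.
by move=> [z0z Uz]; rewrite U_lt// andbT; apply: Uz; rewrite lexx ltW.
Qed.

(** Near such a z the wave stays in ]0, l[, below all jumps of d and away from
    0 and 1; there the flux is given by its formula. *)
Lemma tail_not_boundary z : I z -> ~ boundary (N_ U) z /\ ~ boundary (M_ r m U) z.
Proof.
move=> /tail_range /andP[Uz0' Uzl].
have near_range : \forall x \near z, 0 < U x < l.
  have lo : \forall x \near z, 0 < U x := cU z _ (lt_nbhsr Uz0').
  have hi : \forall x \near z, U x < l := cU z _ (lt_nbhsl Uzl).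
  by apply: filterS2 lo hi => x -> ->.
split; apply: not_boundary; move: near_range; apply: filterS => x /andP[Ux Uxl].
- by move=> [] UE; move: Ux Uxl; rewrite UE; [rewrite ltxx|move=> _; rewrite ltNge (ltW l1)].
- by move=> [i ir UE]; have := m_ge i ir; rewrite -UE ltNge (ltW Uxl).
Unshelve. all: by end_near. Qed.

Lemma tail_derive z : I z -> is_derive z 1 U (derive1 U z).
Proof.
move=> /tail_not_boundary[nN nM]; have [_ [_ dU] _ _ _] := solU.
have [|Uz _] := dU z; first by case.
by split => //; rewrite derive1E.
Qed.

Lemma tail_flux z : I z -> v z = d (U z) * spow p (derive1 U z).
Proof. by move=> /tail_not_boundary[nN nM]; rewrite /v /flux !asboolF. Qed.

Lemma flux_derive z : I z ->
  is_derive z 1 v ((h (U z) - c) * derive1 U z - g (U z)).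
Proof.
move=> Iz; have dU := tail_derive _ Iz.
have [_ _ _ [_ eqU] _] := solU.
pose G := oriented_integral (g \o U) (z - 1).
have cgU : continuous (g \o U) by apply: continuous_comp_within => //; case: hg.
have dG : is_derive z 1 G (g (U z)).
  apply: (@is_derive_oriented_integral R (g \o U) (z - 1) (z + 1)); first lra.
  by apply: continuous_subspaceT.
have dH := h_derive _ (tail_range _ Iz).
pose C := v (z - 1) + c * U (z - 1) - H_ h (U (z - 1)).
(* v in terms of U, H(U) and a primitive of g(U), from the base point z - 1 *)
have -> : v = (cst C - c \*: U + (H_ h \o U)) - G.
  apply/funext => x; have := eqU (z - 1) x; rewrite -/v -/(G x).
  rewrite /C /= !fctE /= -[c *: U x]/(c * U x); lra.
have dHU := is_derive1_comp dH dU.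
have -> : (h (U z) - c) * derive1 U z - g (U z) =
  (0 - c *: derive1 U z + h (U z) * derive1 U z) - g (U z).
  by rewrite /GRing.scale/=; ring.
exact: is_deriveB.
Qed.

Lemma tail_g_gt0 z : I z -> 0 < g (U z).
Proof.
move=> /tail_range /andP[Uz Uzl]; case: hg => _ _ _; apply.
by rewrite Uz (lt_trans Uzl).
Qed.

Lemma tail_d_gt0 z : I z -> 0 < d (U z).
Proof. by move=> /tail_range /andP[Uz Uzl]; apply: d_gt0; rewrite Uz (lt_trans Uzl). Qed.

(** U falls from l to U z, so v < 0 at some x before z; were v z >= 0, then v
    would have a first zero y after x, but v' = - g(U) < 0 at y. *)
Lemma flux_lt0 z : I z -> v z < 0.
Proof.
move=> Iz; have [z0z Uz] := Iz; rewrite ltNge; apply/negP => vz.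
have Ib x : z0 < x <= z -> I x.
  move=> /andP[z0x xz]; split => // y /andP[y1 y2]; apply: Uz.
  by rewrite y1 (le_trans y2).
have [||x] := @MVT _ U (derive1 U) z0 z z0z.
- move=> x /[!in_itv]/= /andP[x1 x2]; apply: tail_derive.
  by apply: Ib; rewrite x1 ltW.
- exact: continuous_subspaceT.
move=> /[!in_itv]/= /andP[z0x xz] UE.
have Ix : I x by apply: Ib; rewrite z0x ltW.
have vx : v x < 0.
  rewrite tail_flux// spow_lt0 ?tail_d_gt0//.
  have := U_lt _ z0z; move: UE; rewrite Uz0; have : 0 < z - z0 by lra.
  nra.
have [y [/andP[xy yz] vy vneg]] := @first_zero R v x z cv (ltW xz) vx vz.
have Iy : I y by apply: Ib; rewrite yz (lt_trans z0x).
have U'y : derive1 U y = 0.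
  by apply: (@spow_eq0 R p _ _ (tail_d_gt0 _ Iy)); rewrite -tail_flux.
have := @is_derive_first_zero R v x y _ (flux_derive _ Iy) xy vy vneg.
by have := tail_g_gt0 _ Iy; rewrite U'y; lra.
Qed.

(** A first zero of U is a boundary point of N_U, where v is 0 by convention:
    just before y the wave takes values in ]0, 1[. *)
Lemma flux_first_zero y :
  z0 < y -> U y = 0 -> (forall x, z0 <= x < y -> 0 < U x) -> v y = 0.
Proof.
move=> z0y Uy Upos; rewrite /v /flux asboolT//; split.
  by apply: subset_closure; left.
move=> /nbhs_ballP[e/= e0 He].
pose x := Num.max ((z0 + y) / 2) (y - e / 2).
have xy : x < y by rewrite gt_max; apply/andP; split; lra.
have yx : y - e / 2 <= x by rewrite le_max lexx orbT.
have z0x : z0 < x by rewrite lt_max; apply/orP; left; lra.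
have := He x; rewrite /ball/= gtr0_norm ?subr_gt0// => /(_ _)[|Ux|Ux]; first lra.
  by have := Upos x; rewrite Ux ltxx (ltW z0x) xy => /(_ isT).
by have := U_lt x z0x; rewrite Ux ltNge (ltW l1).
Qed.

Lemma no_wave_tail n e :
  1 < p -> 0 < n -> 0 < e ->
  U z @[z --> +oo] --> (0 : R) ->
  (forall t, 0 < t < l -> h 0 - e <= h t) ->
  (forall t, 0 < t < l -> n <= d t `^ (p - 1)^-1 * g t / t `^ (p / (p - 1) - 1)) ->
  (forall X, 0 < X -> c - h 0 + e + e <= X + n * X `^ (- (p - 1)^-1)) -> False.
Proof.
move=> p1 n0 e0 U0 he nle yng.
have vp : v z @[z --> +oo] --> (0 : R) by have [_ _ _ _ []] := solU.
have [z1 Iz1] : exists z, I z by apply: tail_nonempty => //; rewrite Uz0.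
have U'lt0 z : I z -> derive1 U z < 0.
  by move=> Iz; rewrite -(@spow_lt0 _ p _ _ (tail_d_gt0 _ Iz)) -tail_flux// flux_lt0.
apply: (@no_decaying_tail R I U (derive1 U) (- v)
  (fun z => - ((h (U z) - c) * derive1 U z - g (U z)))
  (fun X => n * X `^ (- (p - 1)^-1)) (c - h 0 + e) e z1) => //.
- exact: tail_convex.
- exact: tail_derive.
- by move=> z Iz; apply: is_deriveN; exact: flux_derive.
- move=> z Iz; split; [|exact: U'lt0|by rewrite oppr_gt0 flux_lt0].
  by have /andP[] := tail_range _ Iz.
- by move=> X X0; rewrite mulr_ge0 ?powR_ge0// ltW.
- move=> z Iz; have U' := U'lt0 _ Iz; have Uz := tail_range _ Iz.
  have /andP[Uz0' _] := Uz.
  have := @reaction_ge R p (d (U z)) (derive1 U z) (U z) (g (U z)) n p1 (tail_d_gt0 _ Iz) U' Uz0' (nle _ Uz).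
  rewrite -tail_flux//; have := he _ Uz; rewrite /=.
  move: (- v z / U z) => q; move: (n * q `^ _) => Q.
  nra.
- move=> z k0 Iz k00.
  have [z' [Iz' zz' Uz' vz']] := @tail_end R U v z0 cU cv
    (fun z => proj1 (andP (U01 z))) U0 vp flux_first_zero z k0 Iz k00.
  exists z'; split => //; by rewrite ltrNl.
Qed.

End decay.

(** * Nonexistence of slow waves *)

Lemma no_traveling_wave (R : realType) (p : R) (g d h : R -> R)
    (r : nat) (m : nat -> R) (c n : R) (U : R -> R) :
  1 < p -> reaction g -> diffusion d r m -> convection h -> 0 < n ->
  (n%:E < limf_einf (fun t => ((d t `^ (p - 1)^-1 * g t)
                               / t `^ (p / (p - 1) - 1))%:E) (0 : R)^'+)%E ->
  c - h 0 < (p / (p - 1)) `^ (p / (p - 1))^-1 * p `^ p^-1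
            * n `^ (p / (p - 1))^-1 ->
  ~ traveling_wave p g d h r m c U.
Proof.
move=> p1 hg [_ _ d_gt0 [m0 mr m_lt _ _]] [h0 _ [q [k [k0 _ k_lt _ h_cont]]]].
move=> n0 /lt_limf_einf[V V_near V_gt] cK [solU Um Up].
set K := _ * _ * _ in cK.
(* half of the gap: then K = (c - h 0 + e) + e *)
pose e := (K - (c - h 0)) / 2.
have e0 : 0 < e by rewrite /e; lra.
have m1 : 0 < m 1%N by rewrite -m0 m_lt.
have k1 : 0 < k 1%N by rewrite -k0 k_lt.
have : \forall t \near (0 : R)^'+, [/\ V t, h 0 - e < h t, t < m 1%N, t < k 1%N & t < 1].
  have h_near : \forall t \near (0 : R)^'+, h 0 - e < h t.
    by apply: (cvgr_gt (h 0)) => //; lra.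
  near=> t; split; near: t => //.
  - exact: nbhs_right_lt.
  - exact: nbhs_right_lt.
  - exact: nbhs_right_lt.
rewrite /at_right => /nbhs_ballP[s/= s0 small].
have {}small t : 0 < t -> t <= s / 2 ->
    [/\ V t, h 0 - e < h t, t < m 1%N, t < k 1%N & t < 1].
  by move=> t0 ts; apply: small => //; rewrite /ball/= sub0r normrN gtr0_norm//; lra.
pose l := s / 2.
have l0 : 0 < l by rewrite /l; lra.
have [_ _ lm lk l1] := small l l0 (lexx _).
have m_ge i : (1 <= i <= r)%N -> l < m i.
  move=> /andP[i1 ir]; apply: lt_le_trans lm _.
  elim: i i1 ir => // -[//|i] IH _ ir.
  by rewrite (le_trans (IH _ (ltnW ir)))// ltW// m_lt// ltnW.
have [z0 [Uz0 U_lt]] := @last_crossing R U l (proj1 (let: And5 a _ _ _ _ := solU in a)) Um Up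
  (introT andP (conj l0 l1)).
have h_derive u : 0 < u < l -> is_derive u 1 (H_ h) (h u).
  move=> /andP[u0 ul]; apply: (@is_derive_H_ R h (k 1%N)) => //.
  - by rewrite u0 (lt_trans ul).
  - by have := h_cont 0%N (leq0n _); rewrite k0.
apply: (@no_wave_tail R p c g d h r m U l z0 hg d_gt0 m_ge l0 l1 h_derive solU Uz0 U_lt n e) => //.
- by move=> t /andP[t0 tl]; have [_ /ltW] := small t t0 (ltW tl).
- by move=> t /andP[t0 tl]; have [/V_gt/ltW] := small t t0 (ltW tl).
- move=> X X0; have := @conjugate_young R p _ n X p1 n0 X0 erefl.
  by rewrite -/K /e; lra.
Unshelve. all: by end_near. Qed.

Theorem theorem2p2 (R : realType) (p : R) (g d h : R -> R)
    (r : nat) (m : nat -> R)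
    (hp : 1 < p) (hg : reaction g) (hd : diffusion d r m) (hh : convection h) :
  let p' := p / (p - 1) in
  let nu : \bar R :=
    limf_einf (fun t : R => ((d t `^ (p - 1)^-1 * g t) / t `^ (p' - 1))%:E)
              (0 : R)^'+ in
  (0 < nu)%E ->
  (forall c : R, h 0 < c ->
     (c%:E < (h 0)%:E + (p' `^ p'^-1 * p `^ p^-1)%:E * poweR nu p'^-1)%E ->
     ~ exists U : R -> R, traveling_wave p g d h r m c U) /\
  (nu = +oo%E ->
   forall c : R, h 0 < c ->
     ~ exists U : R -> R, traveling_wave p g d h r m c U).
Proof.
move=> p' nu nu0.
have p'0 : 0 < p' by rewrite divr_gt0; lra.
have K0 : 0 < p' `^ p'^-1 * p `^ p^-1 by rewrite mulr_gt0 ?powR_gt0//; lra.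
have slow c : h 0 < c ->
    (c%:E < (h 0)%:E + (p' `^ p'^-1 * p `^ p^-1)%:E * poweR nu p'^-1)%E ->
    ~ exists U : R -> R, traveling_wave p g d h r m c U.
  move=> hc; rewrite -lteBlDl// -EFinB => cK [U].
  have [|||n [n0 n_nu nK]] := @lt_scaled_poweR R nu (c - h 0) _ p'^-1 _ _ _ nu0 cK.
  - lra.
  - by [].
  - by rewrite invr_gt0.
  exact: (@no_traveling_wave R p g d h r m c n U hp hg hd hh n0 n_nu nK).
split=> // nuy c hc; apply: slow => //.
by rewrite nuy poweRyr ?invr_neq0 ?gt_eqF// gt0_muley ?lte_fin// addey// ltry.
Qed.
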